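(* Let $\gamma>0$, $c>0$, and suppose there is a stochastic algorithm $\mathcal{A}$ that, when applied to $F^\gamma_{x_k}$ at stage $k$, finds a solution $x_{k+1}$ satisfying $$\mathbb{E}\Big[F^{\gamma}_{x_k}(x_{k+1})-\min_{x\in\mathbb{R}^d}F^{\gamma}_{x_k}(x)\Big]\le\frac{c}{k},$$ and suppose there exists $\Delta>0$ such that $\mathbb{E}[F(x_k)-\min_xF(x)]\le\Delta$ for all $k\in\{1,\dots,K\}$. Then with a total of $K$ stages, $$\mathbb{E}\big[\|G_\gamma(x_\tau)\|^2\big]\le\frac{2\gamma(\Delta+c)(\alpha+1)}{K},$$ where $\tau\in\{1,\dots,K\}$ is sampled according to the probabilities $p(\tau=k)=k^\alpha/\sum_{j=1}^Kj^\alpha$ with $\alpha\ge1$.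
   Context: Problem: $\min_{x\in\mathbb{R}^d}F(x):=g(x)+r(x)-h(x)$, where $g,h:\mathbb{R}^d\to\mathbb{R}$ are lower-semicontinuous convex functions and $r:\mathbb{R}^d\to\mathbb{R}\cup\{+\infty\}$ is a proper lower-semicontinuous convex function. $\|\cdot\|$ is the Euclidean norm. When $\partial h(z)$ is used as a vector it denotes a fixed chosen subgradient of $h$ at $z$. For $\gamma>0$ and $z\in\mathbb{R}^d$ define $$F^{\gamma}_{z}(x)=g(x)+r(x)-\big(h(z)+\partial h(z)^{\top}(x-z)\big)+\tfrac{\gamma}{2}\|x-z\|^2,$$ $P_\gamma(z)=\arg\min_{x}F^\gamma_z(x)$ and $G_\gamma(z)=\gamma(z-P_\gamma(z))$. Stagewise algorithm: start from $x_1\in\mathrm{dom}(r)$; for $k=1,\dots,K$ let $x_{k+1}$ be the (random) output of $\mathcal{A}$ applied to $F^\gamma_{x_k}$. The index $\tau$ is sampled independently of the algorithm's randomness. *)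

(* Defs.v *)
From HB Require Import structures.
From mathcomp Require Export all_boot all_order all_algebra.
From mathcomp Require Export all_classical all_reals all_analysis.
From mathcomp Require Export measurable_realfun.
Export Order.TTheory GRing.Theory Num.Theory.
Export numFieldNormedType.Exports.

Set Implicit Arguments.
Unset Strict Implicit.
Unset Printing Implicit Defensive.

Local Open Scope classical_set_scope.
Local Open Scope ring_scope.

Definition dotp (R : realType) (d : nat) (u v : 'rV[R]_d) : R :=
  \sum_(i < d) u 0 i * v 0 i.

(* The library norm on 'rV[R]_d is the sup norm, hence this definition. *)
Definition enorm (R : realType) (d : nat) (u : 'rV[R]_d) : R :=
  Num.sqrt (dotp u u).

Definition proper (R : realType) (d : nat) (f : 'rV[R]_d -> \bar R) : Prop :=
  (forall x, f x != -oo%E) /\ (exists x, (f x < +oo)%E).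

Definition dom (R : realType) (d : nat) (f : 'rV[R]_d -> \bar R) :
    set 'rV[R]_d :=
  [set x | (f x < +oo)%E].

(* Intended for functions that never take the value -oo. At t = 0 and t = 1 the
   convention 0 * +oo = 0 makes the inequality trivial. *)
Definition econvex (R : realType) (d : nat) (f : 'rV[R]_d -> \bar R) : Prop :=
  forall (x y : 'rV[R]_d) (t : R), 0 <= t <= 1 ->
    (f (t *: x + (1 - t) *: y)%R <= t%:E * f x + (1 - t)%:E * f y)%E.

Definition subgradient (R : realType) (d : nat) (h : 'rV[R]_d -> R)
    (z v : 'rV[R]_d) : Prop :=
  forall x, h z + dotp v (x - z) <= h x.

Definition argmin (R : realType) (d : nat) (f : 'rV[R]_d -> \bar R) :
    set 'rV[R]_d :=
  [set p | forall x, (f p <= f x)%E].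

(* f x - min f; the minimal value is read as the infimum, so that no
   attainment is presupposed. *)
Definition subopt (R : realType) (d : nat) (f : 'rV[R]_d -> \bar R)
    (x : 'rV[R]_d) : \bar R :=
  (f x - ereal_inf (range f))%E.

Section dc_problem.
Variables (R : realType) (d : nat).
Variables (g h : 'rV[R]_d -> R) (r : 'rV[R]_d -> \bar R).
(* dh z is the chosen subgradient of h at z *)
Variable dh : 'rV[R]_d -> 'rV[R]_d.

Definition dc_obj (x : 'rV[R]_d) : \bar R :=
  ((g x)%:E + r x - (h x)%:E)%E.

Definition surrogate (gamma : R) (z x : 'rV[R]_d) : \bar R :=
  ((g x)%:E + r x - (h z + dotp (dh z) (x - z)%R)%:E
   + (gamma / 2 * enorm (x - z) ^+ 2)%:E)%E.

Definition prox_point (gamma : R) (z : 'rV[R]_d) : 'rV[R]_d :=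
  xget 0 (argmin (surrogate gamma z)).

Definition prox_grad (gamma : R) (z : 'rV[R]_d) : 'rV[R]_d :=
  gamma *: (z - prox_point gamma z).

(* A k f s is the output at stage k of the algorithm run on the objective f,
   when its randomness takes the value s. Stages are numbered from 1:
   iterate 1 = x1 and iterate k.+1 = A k (F_{iterate k}) for k >= 1; the value
   at index 0 is a dummy. *)
Fixpoint iterate (S : Type) (gamma : R)
    (A : nat -> ('rV[R]_d -> \bar R) -> S -> 'rV[R]_d) (x1 : 'rV[R]_d)
    (k : nat) (s : S) {struct k} : 'rV[R]_d :=
  match k with
  | 0 => x1
  | j.+1 => if j == 0%N then x1
            else A j (surrogate gamma (iterate gamma A x1 j s)) s
  end.

End dc_problem.

(* Borel measurability of a random vector *)
Definition random_vector (R : realType) (d : nat) (dS : measure_display)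
    (S : measurableType dS) (X : S -> 'rV[R]_d) : Prop :=
  measurable_fun setT (X : S -> g_sigma_algebraType (@open 'rV[R]_d)).

Definition independent_rv (R : realType) (dO d1 d2 : measure_display)
    (Omega : measurableType dO) (P : probability Omega R)
    (T1 : measurableType d1) (T2 : measurableType d2)
    (X : Omega -> T1) (Y : Omega -> T2) : Prop :=
  forall (B : set T1) (C : set T2), measurable B -> measurable C ->
    P (X @^-1` B `&` Y @^-1` C) = (P (X @^-1` B) * P (Y @^-1` C))%E.

(* Main.v *)
Require Import Defs.
From mathcomp Require Import ring lra.

Set Implicit Arguments.
Unset Strict Implicit.

(* Write m = min F, D_k = F(x_k) - m and E_k for the stage-k gap of the
   surrogate, which is gamma-strongly convex, dominates F, and equals F at its
   base point x_k. Growth at its minimizer P(x_k) gives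
     |G(x_k)|^2 / (2 gamma) + D_{k+1} <= D_k + E_k.
   The minimizer exists because minimizing sets of a strongly convex function
   bounded below (here by m) have diameters tending to 0. Averaging with weights
   k^alpha, Abel summation bounds the telescoping part by Delta K^alpha, the gaps
   contribute at most c K^alpha, and sum_k k^alpha >= K^(alpha+1) / (alpha+1) by
   Bernoulli's inequality.

   The chosen subgradient need not be measurable, hence neither need |G(x_k)|^2;
   it is integrated only through the measurable majorant D_k + E_k - D_{k+1},
   where independence of tau and xi applies. *)

Local Open Scope classical_set_scope.
Local Open Scope ring_scope.

(** * Euclidean inner product and norm on row vectors *)

Section euclid.
Variables (R : realType) (d : nat).
Implicit Types (u v x y : 'rV[R]_d) (t : R).

Lemma dotp_ge0 u : 0 <= dotp u u.
Proof. by apply: sumr_ge0 => i _; rewrite -expr2 sqr_ge0. Qed.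

Lemma enorm_sqr u : enorm u ^+ 2 = dotp u u.
Proof. exact/sqr_sqrtr/dotp_ge0. Qed.

Lemma dotpZl t u v : dotp (t *: u) v = t * dotp u v.
Proof. by rewrite /dotp mulr_sumr; apply: eq_bigr => i _; rewrite mxE mulrA. Qed.

Lemma dotpDr u x y : dotp u (x + y) = dotp u x + dotp u y.
Proof. by rewrite /dotp -big_split; apply: eq_bigr => i _; rewrite mxE mulrDr. Qed.

Lemma dotpC u v : dotp u v = dotp v u.
Proof. by apply: eq_bigr => i _; rewrite mulrC. Qed.

Lemma dotpZr t u v : dotp u (t *: v) = t * dotp u v.
Proof. by rewrite dotpC dotpZl dotpC. Qed.

(** Equality form of strong convexity of the squared norm; the subtracted term becomes the modulus
    [gamma] of the surrogate. *)
Lemma dotp_conv t x y : dotp (t *: x + (1 - t) *: y) (t *: x + (1 - t) *: y) =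
  t * dotp x x + (1 - t) * dotp y y - t * (1 - t) * dotp (x - y) (x - y).
Proof.
rewrite /dotp !mulr_sumr -big_split -sumrB; apply: eq_bigr => i _.
by rewrite /= !mxE; ring.
Qed.

(** Passes from Euclidean estimates to the sup-norm balls of the topology. *)
Lemma coord_sqr_le u i : u 0 i ^+ 2 <= dotp u u.
Proof.
rewrite /dotp (bigD1 i)//= -expr2 lerDl; apply: sumr_ge0 => j _.
by rewrite -expr2 sqr_ge0.
Qed.

Lemma continuous_dotp (X : topologicalType) (p q : X -> 'rV[R]_d) :
  (forall i, continuous (fun w => p w 0 i)) ->
  (forall i, continuous (fun w => q w 0 i)) ->
  continuous (fun w => dotp (p w) (q w)).
Proof.
move=> cp cq; apply: (@continuous_big R _ +%R 0 xpredT) => [|i _ w].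
  by move=> x; apply: cvgD; [exact: cvg_fst|exact: cvg_snd].
by apply: cvgM; [exact: cp|exact: cq].
Qed.

End euclid.

(** * Lower semicontinuity of extended-real functions *)

Section lsc.
Context {R : realType} {X : topologicalType}.
Implicit Types f : X -> \bar R.
Local Open Scope ereal_scope.

(** A real [a] below [f1 x + f2 x] is at most some [a1 + a2] with [a1 < f1 x] and [a2 < f2 x], and
    both strict bounds persist near [x]. *)
Lemma lower_semicontinuousD f1 f2 :
  (forall x, f1 x != -oo) -> (forall x, f2 x != -oo) ->
  lower_semicontinuous f1 -> lower_semicontinuous f2 ->
  lower_semicontinuous (f1 \+ f2).
Proof.
move=> f1Ny f2Ny l1 l2 x a /= ax.
suff [a1 [a2 [aa a1x a2x]]] : exists a1 a2 : R,
    [/\ (a <= a1 + a2)%R, a1%:E < f1 x & a2%:E < f2 x].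
  have [V1 V1x V1a] := l1 _ _ a1x; have [V2 V2x V2a] := l2 _ _ a2x.
  exists (V1 `&` V2); first exact: filterI.
  move=> y [/V1a y1 /V2a y2]; apply: (@le_lt_trans _ _ (a1%:E + a2%:E)).
    by rewrite -EFinD lee_fin.
  exact: lteD.
move: (f1Ny x) (f2Ny x) ax.
case: (f1 x) => [r1||]// _; case: (f2 x) => [r2||]// _ ax.
(* Finite values share the excess over [a] equally; an infinite value absorbs whatever the other
   leaves. *)
- exists (r1 - (r1 + r2 - a) / 2)%R, (r2 - (r1 + r2 - a) / 2)%R.
  by move: ax; rewrite -EFinD !lte_fin => ax; split; lra.
- by exists (r1 - 1)%R, (a - (r1 - 1))%R; rewrite ltry lte_fin; split => //; lra.
- by exists (a - (r2 - 1))%R, (r2 - 1)%R; rewrite ltry lte_fin; split => //; lra.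
- by exists a, 0%R; rewrite !ltry addr0.
Qed.

Lemma continuous_lower_semicontinuous (f : X -> R) :
  continuous f -> lower_semicontinuous (EFin \o f).
Proof.
move=> cf; apply/lower_semicontinuousP => a.
rewrite (_ : [set x | _] = f @^-1` [set y | (a < y)%R]).
  by apply: open_comp => [x _|]; [exact: cf|exact: open_gt].
by apply/seteqP; split => x /=; rewrite lte_fin.
Qed.

End lsc.

(** * Strong convexity: quadratic growth and existence of a minimizer *)

Section strong_convexity.
Variables (R : realType) (d : nat).
Implicit Types (f : 'rV[R]_d -> \bar R).

Definition strongly_convex (gamma : R) f := forall x y (t : R), 0 <= t <= 1 ->
  (f (t *: x + (1 - t) *: y)%R
     + (gamma / 2 * (t * (1 - t) * dotp (x - y) (x - y)))%:E
   <= t%:E * f x + (1 - t)%:E * f y)%E.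

(** Compare [f p] with [f] at [t z + (1 - t) p], divide by [t] and let [t] tend to 0; an explicit
    [t] replaces the limit. *)
Lemma argmin_growth gamma f p z : 0 < gamma -> (forall x, f x != -oo%E) ->
  strongly_convex gamma f -> argmin f p ->
  (f p + (gamma / 2 * dotp (z - p) (z - p))%:E <= f z)%E.
Proof.
move=> g0 fNy scf pmin.
move: (fNy z) (fNy p) (pmin z); case Ez : (f z) => [fz||]//; last first.
  by move=> *; rewrite leey.
case Ep : (f p) => [fp||]// _ _; rewrite lee_fin => pz.
rewrite -EFinD lee_fin; set n := dotp _ _.
have n0 : 0 <= n := dotp_ge0 _.
have key t : 0 < t < 1 -> fp + gamma / 2 * ((1 - t) * n) <= fz.
  move=> /andP[t0 t1].
  have t01 : 0 <= t <= 1 by rewrite !ltW.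
  have := scf z p t t01; rewrite Ez Ep -!EFinM -EFinD => sc.
  have := le_trans (leeD2r _ (pmin _)) sc.
  rewrite Ep -EFinD lee_fin -/n => H.
  by rewrite -(ler_pM2l t0); lra.
rewrite leNgt; apply/negP => lt.
have [nz|n_gt0] : n = 0 \/ 0 < n.
  by rewrite le_eqVlt in n0; case/predU1P: n0 => [<-|]; [left|right].
  by rewrite nz mulr0 addr0 in lt; lra.
have gn0 : 0 < gamma * n by rewrite mulr_gt0.
(* With this [t] the loss [gamma / 2 * t * n] in [key] is half the assumed violation; [t < 1]
   follows from [fp <= fz]. *)
pose t := (fp + gamma / 2 * n - fz) / (gamma * n).
have Ht : t * (gamma * n) = fp + gamma / 2 * n - fz by rewrite divfK// gt_eqF.
have t0 : 0 < t by rewrite divr_gt0// subr_gt0.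
have t1 : t < 1 by rewrite ltr_pdivrMr//; lra.
have := key t; rewrite t0 t1 => /(_ isT) K; nra.
Qed.

(** The sets [Sub e] generate a Cauchy filter; its limit is a minimizer by lower semicontinuity. *)
Lemma argmin_nonempty gamma f : 0 < gamma ->
  strongly_convex gamma f -> lower_semicontinuous f ->
  ereal_inf (range f) \is a fin_num -> argmin f !=set0.
Proof.
move=> g0 scf lf; set m := ereal_inf _ => mfin.
have ge_m x : (m <= f x)%E by apply: ereal_inf_lbound; exists x.
have [m' Em] : exists m', m = m'%:E by exists (fine m); rewrite fineK.
pose Sub (e : R) := [set x | (f x < (m' + e)%:E)%E].
pose F := filter_from [set e : R | 0 < e] Sub.
have Sub0 e : 0 < e -> Sub e !=set0.
  move=> e0; have : (m < (m' + e)%:E)%E by rewrite Em lte_fin ltrDl.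
  by move=> /ereal_inf_lt[_ [x _ <-] xe]; exists x.
have FF : ProperFilter F.
  apply: filter_from_proper => //; apply: filter_from_filter.
    by exists 1; exact: ltr01.
  move=> e1 e2 /= e10 e20; exists (Num.min e1 e2); first by rewrite /= lt_min e10.
  move=> x /= xm; split; apply: (lt_le_trans xm); rewrite lee_fin lerD2l.
    by rewrite ge_min lexx.
  by rewrite ge_min lexx orbT.
(* The value at the midpoint is at least [m'], so [gamma / 8 * dotp (x - y) (x - y)] is below
   [e]. *)
have close e x y : 0 < e -> Sub e x -> Sub e y ->
    dotp (x - y) (x - y) < 8 / gamma * e.
  move=> e0; rewrite /Sub /= => xe ye.
  have t01 : 0 <= (2^-1 : R) <= 1 by apply/andP; split; lra.
  have := scf x y (2^-1) t01.
  move: (ge_m x) (ge_m y) xe ye; rewrite Em.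
  case: (f x) => [fx||]//; case: (f y) => [fy||]//; rewrite !lee_fin !lte_fin.
  move=> mx my xe ye; rewrite -!EFinM -EFinD => sc.
  have := le_trans (leeD2r _ (ge_m _)) sc.
  rewrite Em -EFinD lee_fin; set n := dotp _ _ => H.
  have -> : 8 / gamma * e = (8 * e) / gamma by rewrite mulrAC.
  by rewrite ltr_pdivlMr//; lra.
have cF : cauchy F.
  apply: cauchy_exP => e e0.
  (* Makes the bound [8 / gamma * e'] of [close] equal to [e ^+ 2]. *)
  pose e' := gamma / 8 * e ^+ 2.
  have e'0 : 0 < e' by rewrite mulr_gt0 ?exprn_gt0// divr_gt0.
  have [x xS] := Sub0 e' e'0.
  exists x; exists e' => // y yS.
  have := close _ _ _ e'0 xS yS.
  have -> : 8 / gamma * e' = e ^+ 2.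
    rewrite /e' mulrA mulf_div (mulrC gamma) divff ?mul1r//.
    by rewrite mulf_neq0 ?gt_eqF//; lra.
  move=> xy; split; first exact: e0.
  move=> i j; rewrite ord1.
  have := le_lt_trans (coord_sqr_le (x - y) j) xy; rewrite !mxE => lt.
  by rewrite -ball_normE /= -ltr_sqr ?nnegrE ?normr_ge0 ?ltW// real_normK// num_real.
have [p Fp] : exists p : 'rV[R]_d, F --> p by exists (lim F); exact: cauchy_cvg.
exists p => y; apply: le_trans (ge_m y); rewrite leNgt; apply/negP => mp.
have [a /andP[ma ap]] : exists a : R, (m' < a) && (a%:E < f p)%E.
  move: mp; rewrite Em; case: (f p) => [fp||]//.
  - rewrite lte_fin => lt; exists ((m' + fp) / 2); rewrite lte_fin.
    by apply/andP; split; lra.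
  - by move=> _; exists (m' + 1); rewrite ltry andbT; lra.
have [V Vp Va] := lf _ _ ap.
have [e /= e0 SV] := Fp _ Vp.
(* A point of this sublevel set lies in [V], where [f] exceeds [a], yet its value is below [a]. *)
have ee0 : 0 < Num.min e (a - m') by rewrite lt_min e0 subr_gt0.
have [x xS] := Sub0 _ ee0.
have xV : V x.
  by apply: SV; apply: (lt_le_trans xS); rewrite lee_fin lerD2l ge_min lexx.
have := lt_trans (Va _ xV) xS; rewrite lte_fin => H.
have : Num.min e (a - m') <= a - m' by rewrite ge_min lexx orbT.
by lra.
Qed.

End strong_convexity.

(** * Suboptimality, the surrogate and the descent of one stage *)

Lemma subopt_ge0 (R : realType) (d : nat) (f : 'rV[R]_d -> \bar R) x :
  ereal_inf (range f) \is a fin_num -> (0 <= subopt f x)%E.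
Proof.
rewrite /subopt => mfin; rewrite sube_ge0 ?mfin//.
by apply: ereal_inf_lbound; exists x.
Qed.

Section dc_stage.
Variables (R : realType) (d : nat).
Variables (g h : 'rV[R]_d -> R) (r : 'rV[R]_d -> \bar R).
Hypotheses (g_convex : convex_function (setT : set (convex_lmodType 'rV[R]_d)) g)
  (g_lsc : lower_semicontinuous (EFin \o g))
  (r_proper : proper r) (r_convex : econvex r) (r_lsc : lower_semicontinuous r).
Variable dh : 'rV[R]_d -> 'rV[R]_d.
Hypothesis dh_subgradient : forall z, subgradient h z (dh z).
Variable gamma : R.
Hypothesis gamma_gt0 : 0 < gamma.
Implicit Types x y z : 'rV[R]_d.
Local Notation F := (dc_obj g h r).
Local Notation Fg := (surrogate g h r dh gamma).

(** Collects the real-valued terms other than [g], leaving [r] as the only extended-real one. *)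
Let q z x := gamma / 2 * dotp (x - z) (x - z) - (h z + dotp (dh z) (x - z)).

Let rNy x : r x != -oo%E.
Proof. by case: r_proper. Qed.

Lemma dc_objE x : F x = ((g x - h x)%:E + r x)%E.
Proof. by rewrite /dc_obj addeAC. Qed.

Let surrogateE z x : Fg z x = ((g x + q z x)%:E + r x)%E.
Proof.
rewrite /surrogate enorm_sqr -EFinN -!addeA -EFinD (addeC (r x)) addeA -EFinD.
by rewrite /q (addrC (- _)).
Qed.

(** The linearization of [h] is affine, so the whole defect comes from the squared norm. *)
Let qD z x y (t : R) : q z (t *: x + (1 - t) *: y) =
  t * q z x + (1 - t) * q z y - gamma / 2 * (t * (1 - t) * dotp (x - y) (x - y)).
Proof.
have e : t *: x + (1 - t) *: y - z = t *: (x - z) + (1 - t) *: (y - z).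
  by apply/rowP => i; rewrite !mxE; ring.
have -> : dotp (x - y) (x - y) = dotp (x - z - (y - z)) (x - z - (y - z)).
  by rewrite opprB addrA subrK.
by rewrite /q e dotp_conv (dotpDr (dh z) (t *: _)) !dotpZr; ring.
Qed.

Let convex_g x y (t : R) : 0 <= t <= 1 ->
  g (t *: x + (1 - t) *: y) <= t * g x + (1 - t) * g y.
Proof.
move=> /andP[t0 t1].
by have := g_convex (Itv01 t0 t1) (in_setT x) (in_setT y).
Qed.

Lemma surrogate_strongly_convex z : strongly_convex gamma (Fg z).
Proof.
move=> x y t t01; rewrite !surrogateE !muleDr ?fin_num_adde_defr//.
rewrite [leRHS]addeACA [leLHS]addeAC -!EFinD; apply: leeD; last exact: r_convex.
by rewrite lee_fin qD; have := convex_g x y t01; lra.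
Qed.

Lemma surrogate_lsc z : lower_semicontinuous (Fg z).
Proof.
rewrite (_ : Fg z = ((EFin \o g) \+ (EFin \o q z)) \+ r)%E; last first.
  by apply/funext => x; rewrite surrogateE /= EFinD.
apply: lower_semicontinuousD => //; apply: lower_semicontinuousD => //.
apply: continuous_lower_semicontinuous => x.
have cB i : continuous (fun w : 'rV[R]_d => (w - z) 0 i).
  have -> : (fun w : 'rV[R]_d => (w - z) 0 i) = (fun w => w 0 i - z 0 i).
    by apply/funext => w; rewrite !mxE.
  by move=> w; exact: (cvgB (@coord_continuous R _ _ 0 i w) (cvg_cst _)).
have c1 := continuous_dotp cB cB.
have c2 : continuous (fun w : 'rV[R]_d => dotp (dh z) (w - z)).
  by apply: continuous_dotp => // i; exact: cst_continuous.
exact: (cvgB (cvgM (cvg_cst _) (c1 x)) (cvgD (cvg_cst _) (c2 x))).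
Qed.

Lemma surrogate_ge z x : (F x <= Fg z x)%E.
Proof.
rewrite dc_objE surrogateE leeD2r// lee_fin lerD2l /q.
have := dh_subgradient z x; have := dotp_ge0 (x - z) => n0 sub.
have := mulr_ge0 (ltW gamma_gt0) n0; lra.
Qed.

Lemma surrogate_diag z : Fg z z = F z.
Proof.
rewrite surrogateE dc_objE /q subrr.
have z0 (u : 'rV[R]_d) : dotp u 0 = 0 by apply: big1 => i _; rewrite mxE mulr0.
by rewrite !z0 mulr0 addr0 sub0r.
Qed.

Let surrogateNy z x : Fg z x != -oo%E.
Proof. by rewrite surrogateE adde_eq_ninfty negb_or/=. Qed.

Hypothesis inf_fin : ereal_inf (range F) \is a fin_num.

(** Bounded below through [F], and above by the value at a point where [r] is finite. *)
Lemma surrogate_inf_fin z : ereal_inf (range (Fg z)) \is a fin_num.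
Proof.
have lb : (ereal_inf (range F) <= ereal_inf (range (Fg z)))%E.
  apply: le_ereal_inf_tmp => _ [x _ <-]; apply: le_trans (surrogate_ge z x).
  by apply: ereal_inf_lbound; exists x.
case: r_proper => _ [x0 rx0].
have ub : (ereal_inf (range (Fg z)) < +oo)%E.
  apply: (@le_lt_trans _ _ (Fg z x0)); first by apply: ereal_inf_lbound; exists x0.
  by rewrite surrogateE lte_add_pinfty ?ltry.
rewrite fin_numE -ltNye -ltey ub (lt_le_trans _ lb)// ltNye.
by move: inf_fin; rewrite fin_numE => /andP[].
Qed.

(** Existence of a minimizer rules out the default branch of [xget]. *)
Lemma prox_argmin z : argmin (Fg z) (prox_point g h r dh gamma z).
Proof.
rewrite /prox_point; case: xgetP => [y -> //|no].
have [p pmin] := argmin_nonempty gamma_gt0 (surrogate_strongly_convex z)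
  (@surrogate_lsc z) (surrogate_inf_fin z).
by case: (no p).
Qed.

(** Growth at the minimizer [p] bounds [Fg z p + gamma / 2 * dotp (z - p) (z - p)] by
    [Fg z z = F z]; to this is added [F y <= Fg z y], true for every [y]. *)
Lemma stage_descent z y :
  ((enorm (prox_grad g h r dh gamma z) ^+ 2 / (2 * gamma))%:E + subopt F y
   <= subopt F z + subopt (Fg z) y)%E.
Proof.
set p := prox_point g h r dh gamma z.
have -> : enorm (prox_grad g h r dh gamma z) ^+ 2 / (2 * gamma) =
    gamma / 2 * dotp (z - p) (z - p).
  rewrite enorm_sqr /prox_grad dotpZl dotpZr -/p; field.
  by rewrite gt_eqF.
have := argmin_growth z gamma_gt0 (surrogateNy z)
  (surrogate_strongly_convex z) (prox_argmin z).
rewrite -/p surrogate_diag => growth.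
have Emin : ereal_inf (range (Fg z)) = Fg z p.
  apply/eqP; rewrite eq_le; apply/andP; split.
    by apply: ereal_inf_lbound; exists p.
  by apply: le_ereal_inf_tmp => _ [x _ <-]; exact: prox_argmin.
have := surrogate_inf_fin z; have := surrogate_ge z y.
rewrite /subopt Emin; have := surrogateNy z y.
have : F z != -oo%E by rewrite -surrogate_diag.
have : F y != -oo%E by rewrite dc_objE adde_eq_ninfty negb_or/=.
move: growth inf_fin; set m := ereal_inf _.
case: (Fg z p) => [fp||]// + + + + + + _.
case: m => [m||]//.
case: (F z) => [fz||]//; case: (Fg z y) => [fzy||]//; rewrite ?leey//.
case: (F y) => [fy||]//.
rewrite -?EFinD ?lee_fin => *; lra.
Qed.

End dc_stage.

(** * Power weights: Abel summation and the averaged bound *)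

Section weighted_sums.
Variable R : realType.
Implicit Types (a b y c D : R) (w u e : nat -> R).

(* Young's inequality [y * 1 <= y ^ a / a + 1 / b] with [b] conjugate to [a]. *)
Lemma bernoulli_powR y a : 0 <= y -> 1 < a -> 1 + a * (y - 1) <= y `^ a.
Proof.
move=> y0 a1; have a0 : 0 < a by lra.
have a'0 : 0 < a - 1 by lra.
have b0 : 0 < a / (a - 1) by rewrite divr_gt0.
have ab : a^-1 + (a / (a - 1))^-1 = 1.
  by rewrite invf_div; field; rewrite gt_eqF.
have := conjugate_powR y0 ler01 a0 b0 ab.
rewrite powR1 mulr1 invf_div mul1r -mulrDl ler_pdivlMr// => H; lra.
Qed.

Lemma natr_powRS (n : nat) a : 0 < a -> n%:R `^ (a + 1) = n%:R * n%:R `^ a :> R.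
Proof.
move=> a0; rewrite powRD ?powRr1// 1?mulrC//.
by rewrite (gt_eqF (addr_gt0 a0 ltr01)).
Qed.

(** The induction step is Bernoulli's inequality with exponent [a + 1] at [n / n.+1], multiplied by
    the power [a + 1] of [n.+1]. *)
Lemma sum_powR_ge (n : nat) a : 1 <= a ->
  n%:R * n%:R `^ a <= (a + 1) * \sum_(1 <= j < n.+1) j%:R `^ a :> R.
Proof.
move=> a1; have a0 : 0 < a by lra.
elim: n => [|n IH]; first by rewrite big_geq// mul0r mulr0.
rewrite big_nat_recr//= mulrDr; apply: le_trans (lerD IH (lexx _)).
have N0 : 0 < n.+1%:R :> R by rewrite ltr0n.
have y0 : 0 <= n%:R / n.+1%:R :> R by rewrite divr_ge0.
have aa : 1 < a + 1 by lra.
have := bernoulli_powR y0 aa.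
rewrite -(ler_pM2r (powR_gt0 (a + 1) N0)) -powRM// divfK ?gt_eqF//.
rewrite !natr_powRS// => H; apply: le_trans (lerD H (lexx _)).
have -> : n%:R = n.+1%:R - 1 :> R by rewrite -natr1 addrK.
move: N0; move: n.+1%:R => N N0.
by rewrite le_eqVlt; apply/predU1l; field; rewrite gt_eqF.
Qed.

(** Keeping the remainder [- w n.+1 * u n.+2] lets the induction close: the step amounts to
    [0 <= (w n.+2 - w n.+1) * (D - u n.+2)]. *)
Lemma abel_sum_le w u D (n : nat) : {homo w : i j / (i <= j)%N >-> i <= j} ->
  0 <= w 0%N -> (forall k, (1 <= k <= n.+1)%N -> u k <= D) ->
  \sum_(1 <= k < n.+2) w k * (u k - u k.+1) <= w n.+1 * (D - u n.+2).
Proof.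
move=> wnd w0; elim: n => [|n IH] uD.
  rewrite big_nat1 ler_wpM2l ?(le_trans w0) ?wnd//.
  by have := uD 1%N isT; lra.
rewrite big_nat_recr//=.
have {}IH : \sum_(1 <= k < n.+2) w k * (u k - u k.+1) <= w n.+1 * (D - u n.+2).
  by apply: IH => k /andP[k1 kn]; apply: uD; rewrite k1 leqW.
have uDn : u n.+2 <= D by apply: uD; rewrite leqnn.
have wn : w n.+1 <= w n.+2 by exact: wnd.
have wn0 : 0 <= w n.+1 by rewrite (le_trans w0) ?wnd.
nra.
Qed.

(** Here [u] and [e] stand for expected suboptimalities and gaps. Their sums are at most [D] and [c]
    times the last weight, and the normalization is at least [n.+1 / (a + 1)] times it. *)
Lemma powR_average_le (n : nat) (a c D : R) u e : 1 <= a -> 0 < c -> 0 < D ->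
  (forall k, (1 <= k <= n.+1)%N -> u k <= D) -> 0 <= u n.+2 ->
  (forall k, (1 <= k <= n.+1)%N -> e k <= c / k%:R) ->
  \sum_(1 <= k < n.+2)
    k%:R `^ a / (\sum_(1 <= j < n.+2) j%:R `^ a) * (u k + e k - u k.+1)
  <= (D + c) * (a + 1) / n.+1%:R.
Proof.
move=> a1 c0 D0 uD un0 ec; have a0 : 0 < a by lra.
pose w k : R := k%:R `^ a.
set W := \sum_(1 <= j < n.+2) _.
have wnd : {homo w : i j / (i <= j)%N >-> i <= j}.
  by move=> i j ij; apply: ge0_ler_powR; rewrite ?nnegrE ?ler0n ?ler_nat// ltW.
have w0 : 0 <= w 0%N by exact: powR_ge0.
have N0 : 0 < n.+1%:R :> R by rewrite ltr0n.
have wN0 : 0 < w n.+1 by exact: powR_gt0.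
have Wge : n.+1%:R * w n.+1 <= (a + 1) * W by exact: sum_powR_ge.
have W0 : 0 < W by have := mulr_gt0 N0 wN0; nra.
have S1 := abel_sum_le wnd w0 uD.
have S2 : \sum_(1 <= k < n.+2) w k * e k <= c * w n.+1.
  (* Each term is at most [c] times the power [a - 1] of [k], nondecreasing in [k] since [1 <= a];
     its last value bounds all [n.+1] terms. *)
  apply: (@le_trans _ _ (\sum_(1 <= k < n.+2) (c * w n.+1 / n.+1%:R))).
    apply: ler_sum_nat => k /andP[k1 kn].
    have k0 : 0 < k%:R :> R by rewrite ltr0n.
    have kN : (k <= n.+1)%N by [].
    have wk0 : 0 <= w k by exact: powR_ge0.
    have := ec k; rewrite k1 kN => /(_ isT) ek.
    apply: (le_trans (ler_wpM2l wk0 ek)).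
    have wE (m : nat) : (0 < m)%N -> w m = m%:R * m%:R `^ (a - 1) :> R.
      move=> m0; rewrite -[X in X * _]powRr1// -powRD ?subrKC//.
      by rewrite pnatr_eq0 -lt0n m0 implybT.
    rewrite (wE k)// (wE n.+1)//.
    have : k%:R `^ (a - 1) <= n.+1%:R `^ (a - 1) :> R.
      by apply: ge0_ler_powR; rewrite ?nnegrE ?ler0n ?ler_nat//; lra.
    set A := k%:R `^ _; set B := n.+1%:R `^ _ => AB.
    have -> : k%:R * A * (c / k%:R) = c * A by field; rewrite gt_eqF.
    have -> : c * (n.+1%:R * B) / n.+1%:R = c * B.
      by rewrite mulrCA mulrAC divff ?mul1r// gt_eqF.
    by rewrite ler_pM2l.
  by rewrite sumr_const_nat subn1 /= -[leLHS]mulr_natr divfK// gt_eqF.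
have -> : \sum_(1 <= k < n.+2) k%:R `^ a / W * (u k + e k - u k.+1) =
   (\sum_(1 <= k < n.+2) w k * (u k - u k.+1) + \sum_(1 <= k < n.+2) w k * e k) / W.
  rewrite -big_split mulr_suml; apply: eq_bigr => k _ /=.
  by rewrite /w; field; rewrite gt_eqF.
rewrite ler_pdivrMr// mulrAC -[leRHS]mulrA; apply: (le_trans (lerD S1 S2)).
(* Nonnegativity of [u n.+2] discards the remainder of the Abel summation. *)
apply: (@le_trans _ _ ((D + c) * w n.+1)).
  by have := mulr_ge0 (ltW wN0) un0; nra.
rewrite -[leRHS]mulrA ler_pM2l ?addr_gt0//.
by rewrite mulrA ler_pdivlMr// mulrC.
Qed.

End weighted_sums.

(** * Borel measurability and integrals of nonnegative functions *)

Lemma lower_semicontinuous_borel (R : realType) (d : nat)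
    (f : 'rV[R]_d -> \bar R) : lower_semicontinuous f ->
  measurable_fun setT (f : g_sigma_algebraType (@open 'rV[R]_d) -> \bar R).
Proof.
(* The rays []a, +oo]] generate the Borel sets of the extended reals, and their preimages are
   open. *)
move=> lf; apply: (measurability _ (ErealGenOInfty.measurableE R)).
move=> /= _ [_ [a ->]] <-; rewrite setTI preimage_itvoy.
by apply: sub_sigma_algebra; move/lower_semicontinuousP : lf; exact.
Qed.

Section integration.
Local Open Scope ereal_scope.
Context d (T : measurableType d) (R : realType).

(* No measurability is needed: the integral of a nonnegative function is a
   supremum over the simple functions below it. *)
Lemma le_lower_integral (mu : {measure set T -> \bar R}) (f g : T -> \bar R) :
  (forall x, 0 <= f x) -> (forall x, f x <= g x) ->
  \int[mu]_x f x <= \int[mu]_x g x.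
Proof.
move=> f0 fg; rewrite !ge0_integralTE//; last by move=> x; exact: le_trans (fg x).
by apply: le_ereal_sup => _ [k /= kf <-]; exists k => // x; exact: le_trans (fg x).
Qed.

(** Turns an integral over an event [tau = k] into one against a measure that [xi] can push forward;
    that measure vanishes off [E]. *)
Lemma integral_mrestr (mu : {measure set T -> \bar R}) (E : set T)
    (mE : measurable E) (f : T -> \bar R) :
  measurable_fun setT f -> (forall x, 0 <= f x) ->
  \int[mrestr mu mE]_x f x = \int[mu]_(x in E) f x.
Proof.
move=> mf f0; rewrite -(setUv E) ge0_integral_setU ?setUv//; last 2 first.
- exact: measurableC.
- by rewrite disj_set2E setICr.
rewrite [X in _ + X]null_set_integral ?adde0; last 3 first.
- exact: measurableC.
- exact: measurable_funTS.
- by rewrite /= /mrestr setICl measure0.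
by apply: eq_measure_integral => A _ AE; rewrite /= /mrestr setIidl.
Qed.

(** Domination by [a + b] makes [c] integrable, hence finite almost everywhere, so [fine] alters it
    only on a null set. *)
Lemma integral_subD (mu : {measure set T -> \bar R}) (a b c : T -> \bar R) :
  measurable_fun setT a -> measurable_fun setT b -> measurable_fun setT c ->
  (forall x, 0 <= a x) -> (forall x, 0 <= b x) -> (forall x, 0 <= c x) ->
  (forall x, c x <= a x + b x) ->
  \int[mu]_x a x < +oo -> \int[mu]_x b x < +oo ->
  \int[mu]_x (a x + b x - (fine (c x))%:E) =
  \int[mu]_x a x + \int[mu]_x b x - \int[mu]_x c x.
Proof.
move=> ma mb mc a0 b0 c0 cab ia ib.
have iD : \int[mu]_x (a x + b x) = \int[mu]_x a x + \int[mu]_x b x.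
  by rewrite ge0_integralD.
have mab : measurable_fun setT (fun x => a x + b x) by exact: emeasurable_funD.
have ab0 x : 0 <= a x + b x by rewrite adde_ge0.
have ic : \int[mu]_x c x < +oo.
  by rewrite (le_lt_trans (le_lower_integral mu c0 cab))// iD lte_add_pinfty.
have ci : mu.-integrable setT c.
  apply/integrableP; split => //.
  by under eq_integral do rewrite gee0_abs//.
have mfc : measurable_fun setT (fun x => (fine (c x))%:E).
  by apply/measurable_EFinP; exact: measurableT_comp.
have fc0 x : 0 <= (fine (c x))%:E by rewrite lee_fin fine_ge0.
have icE : \int[mu]_x (fine (c x))%:E = \int[mu]_x c x.
  apply: ge0_ae_eq_integral => //.
  have := integrable_ae measurableT ci.
  by apply: filterS => x /= /(_ Logic.I) cx _; rewrite fineK.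
have fcab x : (fine (c x))%:E <= a x + b x.
  by move: (cab x) (ab0 x); case: (c x).
have v0 x : 0 <= a x + b x - (fine (c x))%:E by rewrite sube_ge0.
have mv : measurable_fun setT (fun x => a x + b x - (fine (c x))%:E).
  exact: emeasurable_funB.
(* Adding [fine (c x)] back leaves only nonnegative integrands; its finite integral is then
   cancelled. *)
have : \int[mu]_x (a x + b x - (fine (c x))%:E) + \int[mu]_x (fine (c x))%:E =
    \int[mu]_x (a x + b x).
  by rewrite -ge0_integralD//; apply: eq_integral => x _; rewrite subeK.
rewrite icE iD => <-; rewrite addeK//.
by rewrite ge0_fin_numE// integral_ge0.
Qed.

End integration.

(** * Expectation at an independent random index *)

Section independent_mixture.
Local Open Scope ereal_scope.
Context dO (Omega : measurableType dO) (R : realType) (P : probability Omega R).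
Context dS (S : measurableType dS) (xi : Omega -> S) (tau : Omega -> nat).
Hypotheses (mxi : measurable_fun setT xi) (mtau : measurable_fun setT tau).
Hypothesis indep : independent_rv P tau xi.

Let mE k : measurable (tau @^-1` [set k]).
Proof. by rewrite -[X in measurable X]setTI; exact: mtau. Qed.

(** By independence, [P] restricted to [tau = k] and pushed forward by [xi] is the law of [xi]
    scaled by the probability of that event. *)
Lemma integral_indep (k : nat) (u : S -> \bar R) :
  measurable_fun setT u -> (forall s, 0 <= u s) ->
  \int[P]_(w in tau @^-1` [set k]) u (xi w) =
  P (tau @^-1` [set k]) * \int[P]_w u (xi w).
Proof.
move=> mu u0; rewrite -integral_mrestr//; last exact: measurableT_comp.
have pE : P (tau @^-1` [set k]) = (fine (P (tau @^-1` [set k])))%:E.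
  by rewrite fineK// fin_num_measure.
have p0 : (0 <= fine (P (tau @^-1` [set k])))%R by rewrite fine_ge0.
rewrite -[LHS](@ge0_integral_pushforward _ _ _ _ _ _ mxi _ setT u)//.
rewrite (eq_measure_integral (mscale (NngNum p0) (pushforward P xi))); last first.
  by move=> B mB _; rewrite /= /mscale/= -pE /pushforward /mrestr setIC indep.
rewrite ge0_integral_mscale//= -pE; congr (_ * _).
by rewrite (@ge0_integral_pushforward _ _ _ _ _ _ mxi _ setT u).
Qed.

Lemma expectation_mixture_le (K : nat) (p : nat -> R) (f : nat -> S -> R)
    (u : nat -> S -> \bar R) :
  (forall k, (1 <= k <= K)%N -> P [set w | tau w = k] = (p k)%:E) ->
  (\sum_(1 <= k < K.+1) p k = 1)%R ->
  (forall k s, (0 <= f k s)%R) ->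
  (forall k, (1 <= k <= K)%N -> measurable_fun setT (u k)) ->
  (forall k s, (1 <= k <= K)%N -> (f k s)%:E <= u k s) ->
  'E_P[(fun w => f (tau w) (xi w))] <=
  \sum_(1 <= k < K.+1) (p k)%:E * \int[P]_w u k (xi w).
Proof.
move=> law p1 f0 mu fu; rewrite unlock.
(* The value [+oo] outside 1..K gives domination at every index; [tau] takes such indices with
   probability 0. *)
pose v k : S -> \bar R := if (1 <= k <= K)%N then u k else cst +oo.
have mv k : measurable_fun setT (v k).
  by rewrite /v; case: ifPn => // /mu.
have fv k s : (f k s)%:E <= v k s.
  by rewrite /v; case: ifPn => [/fu|_]; rewrite ?leey.
have v0 k s : 0 <= v k s by apply: le_trans (fv k s); rewrite lee_fin.
pose E k := tau @^-1` [set k].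
apply: (@le_trans _ _ (\int[P]_w v (tau w) (xi w))).
  by apply: le_lower_integral => w; rewrite ?lee_fin.
have tE : trivIset setT E.
  apply/trivIsetP => i j _ _ /eqP ij; apply/seteqP; split => // w [/= Ei Ej].
  by case: ij; rewrite -Ei -Ej.
have mPhi : measurable_fun setT (fun w => v (tau w) (xi w)).
  rewrite (_ : setT = \bigcup_k E k); last first.
    by apply/seteqP; split => // w _; exists (tau w).
  apply/measurable_fun_bigcup => [|k]; first exact: mE.
  apply: (eq_measurable_fun (v k \o xi)); first by move=> w; rewrite inE => /= ->.
  by apply: measurable_funTS; exact: measurableT_comp.
pose D := \big[setU/set0]_(k <- index_iota 1 K.+1) E k.
have mD : measurable D by apply: bigsetU_measurable => k _; exact: mE.
(* The weights sum to 1, so the complement of [D] is null and contributes nothing. *)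
have PD : P D = 1.
  rewrite /D big_add1 big_mkord/= (measure_bigsetU _ (F := fun i => E i.+1)).
  - rewrite -(big_mkord xpredT (fun i => P (E i.+1))).
    rewrite -(big_add1 _ _ 0 K.+1 xpredT (fun i => P (E i))).
    by rewrite (eq_big_nat _ _ (F2 := fun k => (p k)%:E)) ?sumEFin ?p1.
  - by move=> i; exact: mE.
  - by apply/trivIsetP => i j _ _ ij; move/trivIsetP : tE; apply.
rewrite -(setUv D) ge0_integral_setU ?setUv//; last 2 first.
- exact: measurableC.
- by rewrite disj_set2E setICr.
rewrite [X in _ + X]null_set_integral ?adde0; last 3 first.
- exact: measurableC.
- exact: measurable_funTS.
- by have := probability_setC P mD; rewrite PD subee.
rewrite ge0_integral_bigsetU//; last 3 first.
- exact: iota_uniq.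
- by apply: sub_trivIset tE.
- exact: measurable_funTS.
rewrite le_eqVlt; apply/predU1l; apply: eq_big_nat => k kK.
rewrite -law// -integral_indep//; last 2 first.
- exact: mu.
- by move=> s; have := v0 k s; rewrite /v -[(k <= K)%N]/(k < K.+1)%N kK.
apply: eq_integral => w; rewrite inE => /= ->.
by rewrite /v -[(k <= K)%N]/(k < K.+1)%N kK.
Qed.

End independent_mixture.

(** * The bound for the sampled iterate after K stages *)

Theorem theorem2 (R : realType) (d : nat)
    (g h : 'rV[R]_d -> R) (r : 'rV[R]_d -> \bar R)
    (g_convex : convex_function (setT : set (convex_lmodType 'rV[R]_d)) g)
    (g_lsc : lower_semicontinuous (EFin \o g))
    (h_convex : convex_function (setT : set (convex_lmodType 'rV[R]_d)) h)
    (h_lsc : lower_semicontinuous (EFin \o h))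
    (r_proper : proper r)
    (r_convex : econvex r)
    (r_lsc : lower_semicontinuous r)
    (dh : 'rV[R]_d -> 'rV[R]_d)
    (dh_subgradient : forall z, subgradient h z (dh z))
    (gamma c Delta alpha : R) (K : nat)
    (gamma_gt0 : 0 < gamma) (c_gt0 : 0 < c) (Delta_gt0 : 0 < Delta)
    (alpha_ge1 : 1 <= alpha) (K_gt0 : (0 < K)%N)
    (dO : measure_display) (Omega : measurableType dO)
    (P : probability Omega R)
    (* the randomness of the algorithm *)
    (dS : measure_display) (S : measurableType dS) (xi : Omega -> S)
    (xi_measurable : measurable_fun setT xi)
    (A : nat -> ('rV[R]_d -> \bar R) -> S -> 'rV[R]_d)
    (x1 : 'rV[R]_d) (x1_dom : dom r x1) :
  let F := dc_obj g h r in
  let Fg := surrogate g h r dh gamma in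
  let G := prox_grad g h r dh gamma in
  let x := iterate g h r dh gamma A x1 in
  forall
    (x_measurable : forall k, (1 <= k <= K.+1)%N -> random_vector (x k))
    (gap_measurable : forall k, (1 <= k <= K)%N ->
       measurable_fun (setT : set S)
         (fun s => subopt (Fg (x k s)) (x k.+1 s)))
    (gap_bound : forall k, (1 <= k <= K)%N ->
       (\int[P]_w subopt (Fg (x k (xi w))) (x k.+1 (xi w))
          <= (c / k%:R)%:E)%E)
    (obj_bound : forall k, (1 <= k <= K)%N ->
       (\int[P]_w subopt F (x k (xi w)) <= Delta%:E)%E)
    (tau : Omega -> nat)
    (tau_measurable : measurable_fun setT tau)
    (tau_indep : independent_rv P tau xi)
    (tau_law : forall k, (1 <= k <= K)%N ->
       P [set w | tau w = k] =
         (k%:R `^ alpha / \sum_(1 <= j < K.+1) j%:R `^ alpha)%:E),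
  ('E_P[(fun w => enorm (G (x (tau w) (xi w))) ^+ 2)%R]
     <= (2 * gamma * (Delta + c) * (alpha + 1) / K%:R)%:E)%E.
Proof.
move=> F Fg G x x_measurable gap_measurable gap_bound obj_bound tau tau_measurable
  tau_indep tau_law.
have rNy z : r z != -oo%E by case: r_proper.
have FNy z : F z != -oo%E by rewrite /F dc_objE adde_eq_ninfty negb_or/=.
have inf_fin : ereal_inf (range F) \is a fin_num.
  rewrite fin_numE; apply/andP; split; last first.
    rewrite -ltey; apply: (@le_lt_trans _ _ (F x1)).
      by apply: ereal_inf_lbound; exists x1.
    by rewrite /F dc_objE lte_add_pinfty ?ltry.
  (* An infimum [-oo] would make the suboptimality [+oo] everywhere, against the bound at stage
     1. *)
  apply/negP => /eqP infE; have := obj_bound 1%N; rewrite K_gt0 => /(_ isT).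
  under eq_integral do rewrite /subopt infE/= addey//.
  by rewrite integral_cst//= probability_setT mule1 leye_eq.
have infg_fin z : ereal_inf (range (Fg z)) \is a fin_num.
  exact: (surrogate_inf_fin r_proper dh_subgradient gamma_gt0 inf_fin).
pose D k s := subopt F (x k s).
pose E k s := subopt (Fg (x k s)) (x k.+1 s).
have D0 k s : (0 <= D k s)%E by exact: subopt_ge0.
have E0 k s : (0 <= E k s)%E by exact: subopt_ge0.
have descent k s :
    ((enorm (G (x k s)) ^+ 2 / (2 * gamma))%:E + D k.+1 s <= D k s + E k s)%E.
  exact: stage_descent.
have F_measurable :
    measurable_fun setT (F : g_sigma_algebraType (@open 'rV[R]_d) -> \bar R).
  apply: emeasurable_funB; last exact: lower_semicontinuous_borel h_lsc.
  by apply: emeasurable_funD;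
    [exact: lower_semicontinuous_borel g_lsc|exact: lower_semicontinuous_borel].
have mD k : (1 <= k <= K.+1)%N -> measurable_fun setT (D k).
  move=> kK; apply: emeasurable_funB => //.
  exact: (measurableT_comp F_measurable (x_measurable _ kK)).
have mE k : (1 <= k <= K)%N -> measurable_fun setT (E k) by exact: gap_measurable.
have n0 k s : 0 <= enorm (G (x k s)) ^+ 2 / (2 * gamma).
  by rewrite divr_ge0 ?sqr_ge0// mulr_ge0// ltW.
have DDE k s : (D k.+1 s <= D k s + E k s)%E.
  by apply: le_trans (descent k s); rewrite leeDr// lee_fin.
(* When D_{k+1} = +oo, fine is 0 and the descent inequality forces D_k + E_k = +oo,
   so v still dominates. *)
pose v k s := (D k s + E k s - (fine (D k.+1 s))%:E)%E.
have nv k s : ((enorm (G (x k s)) ^+ 2 / (2 * gamma))%:E <= v k s)%E.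
  rewrite leeBrDr//; move: (descent k s) (D0 k.+1 s).
  case: (D k.+1 s) => [y||]//; rewrite addey// => /(le_trans _) H _.
  by apply: H; rewrite leey.
have v0 k s : (0 <= v k s)%E by apply: le_trans (nv k s); rewrite lee_fin.
have mv k : (1 <= k <= K)%N -> measurable_fun setT (v k).
  move=> /andP[k1 kK]; apply: emeasurable_funB.
    by apply: emeasurable_funD; [apply: mD; rewrite k1 leqW|apply: mE; rewrite k1].
  apply/measurable_EFinP; apply: measurableT_comp => //.
  by apply: mD.
pose dk k := fine (\int[P]_w D k (xi w))%E.
pose ek k := fine (\int[P]_w E k (xi w))%E.
have iD k : (1 <= k <= K)%N -> (\int[P]_w D k (xi w) < +oo)%E.
  by move=> /obj_bound /le_lt_trans; apply; rewrite ltry.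
have iE k : (1 <= k <= K)%N -> (\int[P]_w E k (xi w) < +oo)%E.
  by move=> /gap_bound /le_lt_trans; apply; rewrite ltry.
have iv k : (1 <= k <= K)%N -> (\int[P]_w v k (xi w))%E = (dk k + ek k - dk k.+1)%:E.
  move=> kK; have /andP[k1 kK'] := kK.
  have mDk : measurable_fun setT (fun w => D k (xi w)).
    by apply: measurableT_comp xi_measurable; apply: mD; rewrite k1 leqW.
  have mDk1 : measurable_fun setT (fun w => D k.+1 (xi w)).
    by apply: measurableT_comp xi_measurable; apply: mD.
  have mEk : measurable_fun setT (fun w => E k (xi w)).
    by apply: measurableT_comp xi_measurable; exact: mE.
  rewrite /v (integral_subD (a := D k \o xi) (b := E k \o xi)
    (c := D k.+1 \o xi)) ?iD ?iE//=.
  have fin (a : \bar R) : (0 <= a)%E -> (a < +oo)%E -> a = (fine a)%:E.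
    by move=> a0 aoo; rewrite fineK// ge0_fin_numE.
  (* [obj_bound] stops at stage [K], so for [k = K] finiteness has to come from the descent
     inequality. *)
  have iD1 : (\int[P]_w D k.+1 (xi w) < +oo)%E.
    apply: (@le_lt_trans _ _ (\int[P]_w (D k (xi w) + E k (xi w)))%E).
      by apply: le_lower_integral.
    by rewrite ge0_integralD// lte_add_pinfty ?iD ?iE.
  rewrite (fin _ _ (iD _ kK)) ?integral_ge0// (fin _ _ (iE _ kK)) ?integral_ge0//.
  by rewrite (fin _ _ iD1) ?integral_ge0.
have W0 : 0 < \sum_(1 <= j < K.+1) j%:R `^ alpha :> R.
  rewrite big_ltn// powR1 ltr_pwDl// sumr_ge0// => i _; exact: powR_ge0.
have G2 : 0 < 2 * gamma by rewrite mulr_gt0.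
apply: (le_trans (@expectation_mixture_le _ _ _ _ _ _ _ _ xi_measurable
  tau_measurable tau_indep K (fun k => k%:R `^ alpha / \sum_(1 <= j < K.+1) j%:R `^ alpha)
  (fun k s => enorm (G (x k s)) ^+ 2) (fun k s => (2 * gamma)%:E * v k s)%E
  _ _ _ _ _)).
- exact: tau_law.
- by rewrite -mulr_suml divff// gt_eqF.
- by move=> k s; exact: sqr_ge0.
- by move=> k kK; apply: measurable_funeM; exact: mv.
- move=> k s _; have := lee_wpmul2l (ltW G2 : (0 <= (2 * gamma)%:E)%E) (nv k s).
  by rewrite -EFinM mulrCA divff ?mulr1// gt_eqF.
(* All expectations being finite, the majorant becomes a real weighted sum in the form of
   [powR_average_le]. *)
have -> : (\sum_(1 <= k < K.+1)
    (k%:R `^ alpha / \sum_(1 <= j < K.+1) j%:R `^ alpha)%:E *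
      \int[P]_w ((2 * gamma)%:E * v k (xi w)))%E =
  (2 * gamma * \sum_(1 <= k < K.+1)
    k%:R `^ alpha / (\sum_(1 <= j < K.+1) j%:R `^ alpha)
      * (dk k + ek k - dk k.+1))%:E.
  rewrite mulr_sumr -sumEFin; apply: eq_big_nat => k kK.
  rewrite ge0_integralZl_EFin ?ltW//; last first.
    by apply: measurableT_comp xi_measurable; exact: mv.
  by rewrite iv// -!EFinM mulrCA.
rewrite lee_fin -[leRHS]mulrA -[leRHS]mulrA ler_pM2l// mulrA.
have dk_le k : (1 <= k <= K)%N -> dk k <= Delta.
  move=> kK; rewrite -lee_fin fineK ?ge0_fin_numE ?integral_ge0 ?iD//.
  exact: obj_bound.
have ek_le k : (1 <= k <= K)%N -> ek k <= c / k%:R.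
  move=> kK; rewrite -lee_fin fineK ?ge0_fin_numE ?integral_ge0 ?iE//.
  exact: gap_bound.
have dk0 k : 0 <= dk k by rewrite fine_ge0// integral_ge0.
move: K_gt0 dk_le ek_le; clear -c_gt0 Delta_gt0 alpha_ge1 dk0.
by case: K => // n _ dk_le ek_le; exact: powR_average_le.
Qed.
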